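(* Let $M$ be a monoid and let $L$ be a subgroup of $M$. The assignment $q \mapsto \mathrm{Ker}(q)$ (equivalently, $q \mapsto (L, \mathrm{Ker}(q))$) yields a bijection $$\mathcal{D}_l(M,L) \simeq \mathsf{FAC}(L/M).$$ Its inverse takes $B \in \mathsf{FAC}(L/M)$, i.e. a factorization $(L,B)$ of $M$, to the map $l^B_L$.
   Context: Let $1_M$ be the unit of $M$. A subgroup of a monoid $M$ is a subgroup of the group $U(M)$ of invertible elements of $M$. A pair $(A,B)$ of submonoids of $M$ is a factorization of $M$ if the multiplication map $A \times B \to M$, $(a,b)\mapsto ab$, is bijective. $\mathsf{FAC}(L/M)$ is the set of submonoids $B$ of $M$ such that $(L,B)$ is a factorization of $M$. For such a factorization, $l^B_L : M \to L$ sends $m = ab$ (unique decomposition with $a\in L$, $b \in B$) to $a$. $\mathcal{D}_l(M,L)$ denotes the set of (left) descent 1-cocycles, i.e. maps of sets $q : M \to L$ such that (L1) $q(a) = a$ for all $a \in L$; (L2) $q(am) = a\,q(m)$ for all $a \in L$, $m \in M$; (L3) $q(m_1 m_2) = q(m_1 q(m_2))$ for all $m_1, m_2 \in M$. $\mathrm{Ker}(q) = \{m \in M : q(m) = 1_M\}$. *)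

(* Defs.v *)
From HB Require Import structures.
From mathcomp Require Import all_boot.
From mathcomp Require Import boolp classical_sets functions.

Set Implicit Arguments.
Unset Strict Implicit.
Unset Printing Implicit Defensive.

Local Open Scope classical_set_scope.
Local Open Scope group_scope.

Definition submonoid (M : monoidType) (A : set M) : Prop :=
  monoid_closed [in A].

Definition is_inverse (M : monoidType) (a b : M) : Prop :=
  a * b = 1 /\ b * a = 1.

Definition invertibles (M : monoidType) : set M :=
  [set a | exists b, is_inverse a b].

(* A subgroup of the group [invertibles M]; the last condition is closure
   under inversion, inverses being unique in a monoid. *)
Definition subgroup (M : monoidType) (L : set M) : Prop :=
  [/\ L `<=` @invertibles M,
      submonoid L
    & forall a b, L a -> is_inverse a b -> L b].

Definition factorization (M : monoidType) (A B : set M) : Prop :=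
  [/\ submonoid A,
      submonoid B
    & set_bij (A `*` B) [set: M] (fun ab : M * M => ab.1 * ab.2)].

Definition FAC (M : monoidType) (L : set M) : set (set M) :=
  [set B | submonoid B /\ factorization L B].

(* When (L, B) is a factorization, the set below is the singleton of the
   L-component of m, so the default value 1 is never used. *)
Definition left_component (M : monoidType) (L B : set M) (m : M) : M :=
  xget 1 [set a | L a /\ exists2 b, B b & m = a * b].

(* A map of sets M -> L is represented by a map q : M -> M with values in L. *)
Definition descent_cocycles (M : monoidType) (L : set M) : set (M -> M) :=
  [set q | [/\ set_fun [set: M] L q,
               (forall a, L a -> q a = a),
               (forall a m, L a -> q (a * m) = a * q m)
             & (forall m1 m2, q (m1 * m2) = q (m1 * q m2))]].

Definition cocycle_ker (M : monoidType) (q : M -> M) : set M :=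
  [set m | q m = 1].

(* Main.v *)
(** Given a cocycle q and m in M, put c = (q m)^-1, which exists because L is a
    group.  Then q (c m) = c (q m) = 1, so m = (q m)(c m) decomposes m along
    L and Ker q; since q (a b) = a for a in L and b in Ker q, the decomposition
    is unique and its L-component is q m.  Conversely, for a factorization
    (L, B), writing m2 = a2 b2 and m1 a2 = a b gives m1 m2 = a (b b2), so m1 m2
    and m1 a2 have the same L-component, which is (L3). *)
Require Import Defs.
From HB Require Import structures.
From mathcomp Require Import all_boot.
From mathcomp Require Import boolp classical_sets functions.

Local Open Scope classical_set_scope.

Section DescentCocycles.

Set Implicit Arguments.
Unset Strict Implicit.

Local Open Scope group_scope.

Variable M : monoidType.
Implicit Types (A B L : set M) (q : M -> M).

Lemma submonoidP A :
  submonoid A <-> A 1 /\ (forall x y, A x -> A y -> A (x * y)).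
Proof.
split=> [[A1 AM]|[A1 AM]].
  split; first by move: A1; rewrite !inE.
  by move=> x y Ax Ay; have := AM x y; rewrite !inE; apply.
by split=> [|x y]; rewrite !inE //; apply: AM.
Qed.

Lemma subgroup_inverse L a :
  subgroup L -> L a -> exists2 b, L b & is_inverse a b.
Proof.
by move=> [Linv _ LV] La; have [b ab] := Linv _ La; exists b => //; apply: LV ab.
Qed.

(** Injectivity of multiplication on [L] x [B] makes the set chosen from in [left_component] the
    singleton of [a]. Every later computation of a left component goes through this equation. *)
Lemma left_componentE L B a b :
  factorization L B -> L a -> B b -> left_component L B (a * b) = a.
Proof.
move=> [_ _ [_ inj _]] La Bb; apply: xget_unique; first by split=> //; exists b.
move=> c [Lc [d Bd cd]].
have/(congr1 fst) // : (c, d) = (a, b).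
by apply: inj; rewrite ?inE.
Qed.

Lemma factorization_exists L B m :
  factorization L B -> exists a b, [/\ L a, B b & m = a * b].
Proof.
move=> [_ _ [_ _ surj]]; have [[a b] [/= La Bb] <-] := surj m I.
by exists a, b.
Qed.

Lemma left_component_cocycle L B :
  factorization L B -> descent_cocycles L (left_component L B).
Proof.
move=> fLB; have [/submonoidP[L1 LM] /submonoidP[B1 BM] _] := fLB.
split.
- move=> m _; have [a [b [La Bb ->]]] := factorization_exists m fLB.
  by rewrite left_componentE.
(* (L1): a = a 1 with 1 in [B]. *)
- by move=> a La; rewrite -[a in LHS]mulg1 left_componentE.
- move=> a m La; have [c [b [Lc Bb ->]]] := factorization_exists m fLB.
  by rewrite mulgA !left_componentE //; apply: LM.
- move=> m1 m2; have [a2 [b2 [La2 Bb2 ->]]] := factorization_exists m2 fLB.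
  have [a [b [La Bb m1a2]]] := factorization_exists (m1 * a2) fLB.
  rewrite mulgA [left_component L B (a2 * b2)]left_componentE // m1a2 -mulgA.
  by rewrite !left_componentE //; apply: BM.
Qed.

Lemma cocycle_mul_ker L q a b :
  descent_cocycles L q -> L a -> cocycle_ker q b -> q (a * b) = a.
Proof. by move=> [_ _ qL _] La qb; rewrite qL // qb mulg1. Qed.

Lemma cocycle_decomposition L q m : subgroup L -> descent_cocycles L q ->
  exists2 b, cocycle_ker q b & m = q m * b.
Proof.
move=> sgL [qmL _ qL _]; have Lqm : L (q m) by apply: qmL.
have [c Lc [qc cq]] := subgroup_inverse sgL Lqm.
by exists (c * m); rewrite /cocycle_ker /= ?qL // mulgA qc mul1g.
Qed.

(** (L1) at 1 gives q 1 = 1; for x, y in the kernel, (L3) gives q (x y) = q (x (q y)) = q x = 1. *)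
Lemma cocycle_ker_submonoid L q :
  submonoid L -> descent_cocycles L q -> submonoid (cocycle_ker q).
Proof.
move=> /submonoidP[L1 _] [_ qid _ qM]; apply/submonoidP; split; first exact: qid.
by move=> x y qx qy; rewrite /cocycle_ker /= qM qy mulg1.
Qed.

Lemma cocycle_ker_factorization L q :
  subgroup L -> descent_cocycles L q -> factorization L (cocycle_ker q).
Proof.
move=> sgL cq; have [_ smL _] := sgL.
split=> //; first exact: cocycle_ker_submonoid cq.
split=> //.
- move=> [a b] [a' b'] /[!inE] -[/= La Kb] [/= La' Kb'] eq_ab.
  have eq_a : a = a'.
    by rewrite -(cocycle_mul_ker cq La Kb) eq_ab (cocycle_mul_ker cq La' Kb').
  (* A monoid need not be cancellative, but [a] is invertible: multiplying a b = a b' on the left by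
     its inverse [c] gives b = b'. *)
  have [c _ [_ ca]] := subgroup_inverse sgL La.
  move: eq_ab; rewrite -eq_a => /(congr1 (fun x => c * x)).
  by rewrite !mulgA ca !mul1g => ->.
- move=> m _; have [b Kb m_qb] := cocycle_decomposition m sgL cq.
  by exists (q m, b) => //; split=> //=; case: cq => qL _ _ _; apply: qL.
Qed.

Lemma cocycle_kerK L q :
  subgroup L -> descent_cocycles L q -> left_component L (cocycle_ker q) = q.
Proof.
move=> sgL cq; apply/funext => m.
have [b Kb m_qb] := cocycle_decomposition m sgL cq.
rewrite [in LHS]m_qb left_componentE //; first exact: cocycle_ker_factorization.
by case: cq => qL _ _ _; apply: qL.
Qed.

(** If m = a b has left component 1, then a = 1 and m = b lies in [B]; conversely, m in [B]
    decomposes as 1 m. *)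
Lemma left_componentK L B :
  factorization L B -> cocycle_ker (left_component L B) = B.
Proof.
move=> fLB; have [/submonoidP[L1 _] /submonoidP[B1 _] _] := fLB.
apply/seteqP; split=> m; rewrite /cocycle_ker /=.
  have [a [b [La Bb ->]]] := factorization_exists m fLB.
  by rewrite left_componentE // => ->; rewrite mul1g.
by move=> Bm; rewrite -[m]mul1g left_componentE.
Qed.

End DescentCocycles.

(* The last three conjuncts say that B |-> left_component L B is a map from
   FAC L to descent_cocycles L inverse to q |-> cocycle_ker q. *)
Theorem theorem2p17 (M : monoidType) (L : set M) (L_subgroup : subgroup L) :
  [/\ set_bij (descent_cocycles L) (FAC L) (@cocycle_ker M),
      set_bij (descent_cocycles L)
        [set AB : set M * set M | AB.1 = L /\ factorization AB.1 AB.2]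
        (fun q => (L, cocycle_ker q)),
      set_fun (FAC L) (descent_cocycles L) (left_component L),
      (forall q, descent_cocycles L q ->
         left_component L (cocycle_ker q) = q)
    & (forall B, FAC L B -> cocycle_ker (left_component L B) = B)].
Proof.
have kerF q : descent_cocycles L q -> factorization L (cocycle_ker q).
  exact: cocycle_ker_factorization.
have kerK q : descent_cocycles L q -> left_component L (cocycle_ker q) = q.
  exact: cocycle_kerK.
(* A cocycle is recovered from its kernel by [left_component L], so the kernel determines it. *)
have ker_inj q1 q2 : descent_cocycles L q1 -> descent_cocycles L q2 ->
    cocycle_ker q1 = cocycle_ker q2 -> q1 = q2.
  by move=> c1 c2 eq_ker; rewrite -(kerK _ c1) eq_ker kerK.
split.
- split.
  + by move=> q /kerF fq; split=> //; case: fq.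
  + by move=> q1 q2 /[!inE]; apply: ker_inj.
  + move=> B [_ fLB]; exists (left_component L B).
      exact: left_component_cocycle.
    exact: left_componentK.
- split.
  + by move=> q /kerF.
  + by move=> q1 q2 /[!inE] c1 c2 [/ker_inj]; apply.
  + move=> [A B] [/= -> fLB]; exists (left_component L B).
      exact: left_component_cocycle.
    by rewrite left_componentK.
- by move=> B [_]; apply: left_component_cocycle.
- exact: kerK.
- by move=> B [_]; apply: left_componentK.
Qed.
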